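(* Let $G$ be a finitely generated group and let $\nu$ be a symmetric finitely supported probability measure on $G$ whose support generates $G$. Assume that there exists $\gamma<1$ such that $\nu^{(n)}(1)\succeq e^{-n^{\gamma}}$, i.e. there are constants $c,C>0$ with $\nu^{(n)}(1)\geq c\,e^{-Cn^{\gamma}}$ for all even $n\geq 1$. Then $$\alpha_{G,2}\geq (1-\gamma)/2.$$
   Context: $\nu^{(n)}=\nu\ast\cdots\ast\nu$ ($n$ times) is the $n$-th convolution power, so $\nu^{(n)}(1)$ is the probability of return at time $n$ of the random walk starting at $1$ with transition probability given by $\nu$. **Isoperimetric exponent.** Let $S$ be a finite symmetric generating subset of $G$, $|g|_S=\inf\{n\in\mathbb{N}: g\in S^n\}$ and $B(1,t)$ the ball of radius $t$ around $1$ for $|\cdot|_S$. For a function $\varphi$ on $G$ put $|\tilde{\nabla}\varphi|(g)=\sup_{s\in S}|\varphi(sg)-\varphi(g)|$, and $$J^b_{G,2}(t)=\sup_{\varphi}\frac{\|\varphi\|_2}{\|\tilde{\nabla}\varphi\|_2},$$ where the supremum is over all nonzero functions $\varphi\in \ell^2(G)$ with support in $B(1,t)$. Define $$\alpha_{G,2}=\liminf_{t\to\infty}\frac{\log J^b_{G,2}(t)}{\log t}.$$ *)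

(* Defs.v *)
From HB Require Import structures.
From mathcomp Require Import all_boot all_order all_algebra.
From mathcomp Require Import all_classical all_reals all_analysis.

Set Implicit Arguments.
Unset Strict Implicit.
Unset Printing Implicit Defensive.

Import Order.TTheory GRing.Theory Num.Theory.
Import numFieldNormedType.Exports.

Local Open Scope classical_set_scope.
Local Open Scope ring_scope.

Section Groups.
Variable G : groupType.
Implicit Types A H S : set G.

Definition is_subgroup H : Prop :=
  [/\ H 1%g,
      (forall x y, H x -> H y -> H (x * y)%g) &
      (forall x, H x -> H x^-1%g)].

Definition generates A : Prop := smallest is_subgroup A = [set: G].

Definition finitely_generated : Prop :=
  exists A, finite_set A /\ generates A.

Definition symmetric_set S : Prop := forall s, S s -> S s^-1%g.

(* S^n = products of exactly n elements of S. *)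
Fixpoint set_pow S (n : nat) : set G :=
  if n is n'.+1 then [set (s * g)%g | s in S & g in set_pow S n']
  else [set 1%g].

(* The infimum of the empty set is +oo; it does not occur when S is symmetric
   and generating. *)
Definition word_length (R : realType) S (g : G) : \bar R :=
  ereal_inf [set (n%:R)%:E | n in [set n | set_pow S n g]].

Definition word_ball (R : realType) S (t : R) : set G :=
  [set g | (word_length R S g <= t%:E)%E].

End Groups.

Section Measures.
Variables (R : realType) (G : groupType).
Implicit Types mu nu : G -> R.

(* Measures on the discrete group G are given by their mass functions. The
   sums below run over the support of the summand, which is finite as soon as
   nu is finitely supported. *)
Definition finitely_supported_probability nu : Prop :=
  [/\ finite_set (nu @^-1` [set~ 0]),
      (forall g, 0 <= nu g) &
      \sum_(g \in [set: G]) nu g = 1].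

Definition symmetric_measure nu : Prop := forall g, nu g^-1%g = nu g.

Definition convolution mu nu : G -> R :=
  fun g => \sum_(h \in [set: G]) mu h * nu (h^-1 * g)%g.

Definition convolution_power nu (n : nat) : G -> R :=
  iter n (convolution nu) \1_[set 1%g].

End Measures.

Section Isoperimetry.
Variables (R : realType) (G : groupType).
Implicit Types (S : set G) (phi : G -> R).

Definition l2norm phi : \bar R :=
  sqrte (\esum_(g in [set: G]) (phi g ^+ 2)%:E).

(* [sup] of the empty set is 0, the right value when S is empty (which forces
   G to be trivial). *)
Definition gradient S phi : G -> R :=
  fun g => sup [set `|phi (s * g)%g - phi g| | s in S].

(* Division in [\bar R] satisfies x / 0 = +oo for x > 0. The denominator
   vanishes only when G is finite and phi is constant, and then J = +oo. *)
Definition isoperimetric_J S (t : R) : \bar R :=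
  ereal_sup [set (l2norm phi / l2norm (gradient S phi))%E | phi in
    [set phi : G -> R |
      [/\ phi <> cst 0, (l2norm phi < +oo)%E &
          phi @^-1` [set~ 0] `<=` word_ball S t]]].

Definition isoperimetric_exponent S : \bar R :=
  limf_einf (fun t : R => (lne (isoperimetric_J S t) / (ln t)%:E)%E)
            (pinfty_nbhs R).

End Isoperimetry.

(* Main.v *)
(* Let P be convolution by nu and p_n = nu^(n)(1), so that <nu^(i), nu^(j)> =
   p_(i+j). A lower bound exp(-A m^g) on p_(2m) forces, for some k < m,
   p_(2k) - p_(2k+2) <= A m^(g-1) p_(2k); then phi = nu^(k) + nu^(k+1) has
   Dirichlet energy <(1 - P) phi, phi> <= 2 (p_(2k) - p_(2k+2)), norm
   ||phi||^2 >= p_(2k), and support in a ball of radius O(m). Since supp nu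
   generates G, the energy controls ||phi(x .) - phi||^2 for every x in G, hence
   the gradient along S. If gamma <= 0, the same functions show that phi stays
   bounded below on any finite set of translates of 1 while having mass 2, so
   G is finite and constant functions are admissible test functions. *)
Require Import Defs.
From mathcomp Require Import all_boot all_order all_algebra.
From mathcomp Require Import all_classical all_reals all_analysis.
From mathcomp Require Import finmap ring lra.

Set Implicit Arguments.
Unset Strict Implicit.
Unset Printing Implicit Defensive.

Import Order.TTheory GRing.Theory Num.Theory.
Import numFieldNormedType.Exports.

Local Open Scope classical_set_scope.
Local Open Scope ring_scope.

(** * Sums of finitely supported functions *)

Section FiniteSupport.
Variables (R : realType) (T : choiceType).
Implicit Types f g : T -> R.

Definition has_finsupp f : Prop := finite_set (f @^-1` [set~ 0]).

(** This sum takes the default value 0 when the support of [f] is infinite, so additivity and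
    monotonicity require [has_finsupp]. *)
Definition fsum f : R := \sum_(x \in [set: T]) f x.

Lemma finsupp_sub f g :
  has_finsupp f -> (forall x, f x = 0 -> g x = 0) -> has_finsupp g.
Proof.
by move=> ff fg; apply: sub_finite_set ff => x /= gx /fg /gx.
Qed.

Lemma finsupp0 : has_finsupp (fun=> 0).
Proof.
apply: (@sub_finite_set _ _ set0); last exact: finite_set0.
by move=> x /=; apply.
Qed.

Lemma finsuppD f g : has_finsupp f -> has_finsupp g -> has_finsupp (fun x => f x + g x).
Proof.
move=> ff fg; have fU : finite_set (f @^-1` [set~ 0] `|` g @^-1` [set~ 0]).
  by rewrite finite_setU.
apply: sub_finite_set fU => x /= fgx.
have [fx|/eqP fx] := eqVneq (f x) 0; last by left.
by right=> gx; apply: fgx; rewrite fx gx addr0.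
Qed.

Lemma finsuppZ a f : has_finsupp f -> has_finsupp (fun x => a * f x).
Proof. by move/finsupp_sub; apply=> x ->; rewrite mulr0. Qed.

Lemma finsuppMr f g : has_finsupp f -> has_finsupp (fun x => f x * g x).
Proof. by move/finsupp_sub; apply=> x ->; rewrite mul0r. Qed.

Lemma finsuppX2 f : has_finsupp f -> has_finsupp (fun x => f x ^+ 2).
Proof. by move/finsupp_sub; apply=> x ->; rewrite expr0n. Qed.

Lemma finsuppN f : has_finsupp f -> has_finsupp (fun x => - f x).
Proof. by move/finsupp_sub; apply=> x ->; rewrite oppr0. Qed.

Lemma finsuppB f g : has_finsupp f -> has_finsupp g -> has_finsupp (fun x => f x - g x).
Proof. by move=> ff /finsuppN; apply: finsuppD. Qed.

Lemma finsupp_sum (I : Type) (s : seq I) (F : I -> T -> R) :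
  (forall i, has_finsupp (F i)) -> has_finsupp (fun x => \sum_(i <- s) F i x).
Proof.
move=> fF; elim: s => [|i s IH].
  by apply: finsupp_sub finsupp0 _ => x _; rewrite big_nil.
apply: finsupp_sub (finsuppD (fF i) IH) _ => x.
by rewrite big_cons.
Qed.

Lemma fsum_fset f (A : {fset T}) :
  (forall x, x \notin A -> f x = 0) -> fsum f = \sum_(x <- A) f x.
Proof. exact: fsbigTE. Qed.

Lemma eq_fsum f g : f =1 g -> fsum f = fsum g.
Proof. by move=> fg; apply: eq_fsbigr => x _. Qed.

Lemma finsupp_fset f :
  has_finsupp f -> forall x, x \notin fset_set (f @^-1` [set~ 0]) -> f x = 0.
Proof.
move=> ff x; rewrite in_fset_set // => /negP xf.
by apply: contrapT => fx; apply: xf; exact: mem_set.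
Qed.

Lemma fsumD f g : has_finsupp f -> has_finsupp g ->
  fsum (fun x => f x + g x) = fsum f + fsum g.
Proof.
move=> ff fg.
pose A := (fset_set (f @^-1` [set~ 0]) `|` fset_set (g @^-1` [set~ 0]))%fset.
have fA x : x \notin A -> f x = 0.
  by rewrite in_fsetE => /norP[/(finsupp_fset ff)].
have gA x : x \notin A -> g x = 0.
  by rewrite in_fsetE => /norP[_ /(finsupp_fset fg)].
rewrite (fsum_fset fA) (fsum_fset gA) -big_split /=.
by apply: fsum_fset => x xA; rewrite fA // gA // addr0.
Qed.

Lemma fsumZ a f : fsum (fun x => a * f x) = a * fsum f.
Proof. by rewrite /fsum mulr_fsumr. Qed.

Lemma fsumN f : fsum (fun x => - f x) = - fsum f.
Proof. by rewrite -mulN1r -fsumZ; apply: eq_fsum => x; rewrite mulN1r. Qed.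

Lemma fsumB f g : has_finsupp f -> has_finsupp g ->
  fsum (fun x => f x - g x) = fsum f - fsum g.
Proof. by move=> ff fg; rewrite fsumD ?fsumN //; apply: finsuppN. Qed.

Lemma fsum_sum (I : Type) (s : seq I) (F : I -> T -> R) :
  (forall i, has_finsupp (F i)) ->
  fsum (fun x => \sum_(i <- s) F i x) = \sum_(i <- s) fsum (F i).
Proof.
move=> fF; elim: s => [|i s IH].
  by rewrite big_nil; apply: fsbig1 => x _; rewrite big_nil.
rewrite big_cons -IH -fsumD; [|exact: fF|exact: finsupp_sum].
by apply: eq_fsum => x; rewrite big_cons.
Qed.

Lemma fsum_ge0 f : (forall x, 0 <= f x) -> 0 <= fsum f.
Proof. by move=> f0; apply: fsumr_ge0. Qed.

Lemma ler_fsum f g : has_finsupp f -> has_finsupp g -> (forall x, f x <= g x) ->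
  fsum f <= fsum g.
Proof.
move=> ff fg le_fg; rewrite -subr_ge0 -fsumB //.
by apply: fsum_ge0 => x; rewrite subr_ge0.
Qed.

Lemma ler_sum_fsum f (s : seq T) : uniq s -> has_finsupp f ->
  (forall x, 0 <= f x) -> \sum_(x <- s) f x <= fsum f.
Proof.
move=> us ff f0; rewrite fsbig_seq // fsbig_mkcond.
apply: ler_fsum => // [|x].
  by apply: finsupp_sub ff _ => x; rewrite /patch => ->; case: ifP.
by rewrite /patch; case: ifP.
Qed.

Lemma fsum_indic1 f a : fsum (fun x => \1_[set a] x * f x) = f a.
Proof.
rewrite (@fsum_fset _ [fset a]%fset).
  by rewrite big_seq_fset1 indicE mem_set // mul1r.
move=> x; rewrite in_fset1 => /eqP xa.
by rewrite indicE memNset // mul0r.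
Qed.

(** Passage from the extended-real sums inside [l2norm] to real finite sums. *)
Lemma esum_fsum f : has_finsupp f -> (forall x, 0 <= f x) ->
  (\esum_(x in [set: T]) (f x)%:E = (fsum f)%:E)%E.
Proof.
move=> ff f0.
set A := f @^-1` [set~ 0].
have -> : (\esum_(x in [set: T]) (f x)%:E = \esum_(x in A) (f x)%:E)%E.
  rewrite [RHS]esum_mkcond; apply: eq_esum => x _; case: ifPn => //.
  by rewrite notin_setE /A /= => /contrapT ->.
rewrite esum_fset //; last by move=> x _; rewrite lee_fin.
rewrite fsbig_finite // (fsum_fset (finsupp_fset ff)).
by rewrite sumEFin.
Qed.

End FiniteSupport.

(** * Invariance of sums under translation and inversion *)

Section Shift.
Variables (R : realType) (G : groupType).
Implicit Types f g : G -> R.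

Lemma finsupp_shift a f : has_finsupp f -> has_finsupp (fun x => f (a * x)%g).
Proof.
have inj : {in (fun x => a * x)%g @^-1` (f @^-1` [set~ 0]) &,
    injective (fun x => (a * x)%g)} by move=> x y _ _; exact: mulgI.
exact: finite_preimage inj.
Qed.

Lemma fsum_shift a f : fsum (fun x => f (a * x)%g) = fsum f.
Proof.
rewrite /fsum [RHS](@reindex_fsbigT _ _ _ _ _ (fun x => (a * x)%g)) //.
by exists (fun x => (a^-1 * x)%g) => x; rewrite ?mulKg ?mulVKg.
Qed.

Lemma fsum_inv f : fsum (fun x => f x^-1%g) = fsum f.
Proof.
rewrite /fsum [RHS](@reindex_fsbigT _ _ _ _ _ (fun x => x^-1%g)) //.
by exists (fun x => x^-1%g) => x; rewrite invgK.
Qed.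

End Shift.

(** * The squared l2 distance between a function and its translates *)

Section Translation.
Variables (R : realType) (G : groupType).
Implicit Types (f phi : G -> R) (x y : G).

Definition translation_defect phi x : R :=
  fsum (fun g => (phi (x * g)%g - phi g) ^+ 2).

Lemma finsupp_translation phi x : has_finsupp phi ->
  has_finsupp (fun g => (phi (x * g)%g - phi g) ^+ 2).
Proof.
by move=> fphi; apply/finsuppX2/finsuppB => //; apply: finsupp_shift.
Qed.

Lemma translation_defect_ge0 phi x : 0 <= translation_defect phi x.
Proof. by apply: fsum_ge0 => g; apply: sqr_ge0. Qed.

Lemma translation_defect1 phi : translation_defect phi 1%g = 0.
Proof. by apply: fsbig1 => g _; rewrite mul1g subrr expr0n. Qed.

Lemma translation_defectV phi x :
  translation_defect phi x^-1%g = translation_defect phi x.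
Proof.
rewrite /translation_defect -(fsum_shift x); apply: eq_fsum => g.
by rewrite mulKg -sqrrN opprB.
Qed.

(** The square root of the defect is subadditive in [x]; the factor 2 is the price of working with
    squares. The defect of [x] is first reindexed by [y], so that both differences share the middle
    value [phi (y * g)]. *)
Lemma translation_defectM phi x y : has_finsupp phi ->
  translation_defect phi (x * y)%g <=
  2 * translation_defect phi x + 2 * translation_defect phi y.
Proof.
move=> fphi; rewrite /translation_defect.
rewrite -(fsum_shift y (fun g => (phi (x * g)%g - phi g) ^+ 2)) -!fsumZ -fsumD.
- apply: ler_fsum => [||g].
  + exact: finsupp_translation.
  + apply: finsuppD; apply: finsuppZ; last exact: finsupp_translation.
    by have := finsupp_shift y (finsupp_translation x fphi).
  + rewrite -mulgA; set a := phi _; set b := phi (y * g)%g; set c := phi g.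
    (* Parallelogram identity: 2(a-b)^2 + 2(b-c)^2 - (a-c)^2 is this square. *)
    have : 0 <= ((a - b) - (b - c)) ^+ 2 by exact: sqr_ge0.
    rewrite !expr2; lra.
- by apply: finsuppZ; have := finsupp_shift y (finsupp_translation x fphi).
- by apply: finsuppZ; exact: finsupp_translation.
Qed.

End Translation.

(** * The Markov operator of [nu] and its Dirichlet form *)

Section Convolution.
Variables (R : realType) (G : groupType) (nu : G -> R).
Hypothesis nu_prob : finitely_supported_probability nu.
Hypothesis nu_sym : symmetric_measure nu.
Implicit Types (f phi : G -> R) (x y : G).

Let P := convolution nu.
Let us := fset_set (nu @^-1` [set~ 0]).

Let nu_fin : has_finsupp nu. Proof. by case: nu_prob. Qed.
Let nu_ge0 g : 0 <= nu g. Proof. by case: nu_prob. Qed.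

Lemma fsum_nu (F : G -> R) : fsum (fun h => nu h * F h) = \sum_(h <- us) nu h * F h.
Proof.
by apply: fsum_fset => x /(finsupp_fset nu_fin) ->; rewrite mul0r.
Qed.

Lemma sum_nu1 : \sum_(h <- us) nu h = 1.
Proof.
have [_ _ <-] := nu_prob.
by rewrite -/(fsum nu) (fsum_fset (finsupp_fset nu_fin)).
Qed.

Lemma sum_nuV (F : G -> R) :
  \sum_(h <- us) nu h * F h^-1%g = \sum_(h <- us) nu h * F h.
Proof.
rewrite -!fsum_nu -[RHS]fsum_inv; apply: eq_fsum => h.
by rewrite nu_sym.
Qed.

Lemma convolutionE f g : P f g = \sum_(h <- us) nu h * f (h^-1 * g)%g.
Proof. exact: (fsum_nu (fun h => f (h^-1 * g)%g)). Qed.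

Lemma convolutionD f1 f2 g : P (fun x => f1 x + f2 x) g = P f1 g + P f2 g.
Proof.
by rewrite !convolutionE -big_split /=; apply: eq_bigr => h _; rewrite mulrDr.
Qed.

Lemma convolutionZ a f g : P (fun x => a * f x) g = a * P f g.
Proof.
by rewrite !convolutionE mulr_sumr; apply: eq_bigr => h _; rewrite mulrCA.
Qed.

Lemma finsupp_convolution f : has_finsupp f -> has_finsupp (P f).
Proof.
move=> ff; rewrite (funext (convolutionE f)).
by apply: finsupp_sum => h; apply/finsuppZ/finsupp_shift.
Qed.

Lemma fsum_convolution f : has_finsupp f -> fsum (P f) = fsum f.
Proof.
move=> ff; rewrite (eq_fsum (convolutionE f)) fsum_sum.
  under eq_bigr do rewrite fsumZ fsum_shift.
  by rewrite -mulr_suml sum_nu1 mul1r.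
by move=> h; apply/finsuppZ/finsupp_shift.
Qed.

Lemma fsum_convolutionM f1 f2 : has_finsupp f1 ->
  fsum (fun g => P f1 g * f2 g) =
  \sum_(h <- us) nu h * fsum (fun g => f1 (h^-1 * g)%g * f2 g).
Proof.
move=> ff; under [RHS]eq_bigr do rewrite -fsumZ.
rewrite -fsum_sum.
  apply: eq_fsum => g; rewrite convolutionE mulr_suml.
  by apply: eq_bigr => h _; rewrite mulrA.
by move=> h; apply/finsuppZ/finsuppMr/finsupp_shift.
Qed.

(** The adjoint of translation by [h] is translation by its inverse, and the symmetry of [nu] gives
    both the same weight. *)
Lemma convolution_selfadjoint f1 f2 : has_finsupp f1 -> has_finsupp f2 ->
  fsum (fun g => P f1 g * f2 g) = fsum (fun g => f1 g * P f2 g).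
Proof.
move=> ff1 ff2; under [RHS]eq_fsum do rewrite mulrC.
rewrite !fsum_convolutionM // -sum_nuV; apply: eq_bigr => h _; congr (_ * _).
rewrite -(fsum_shift h^-1%g) invgK; apply: eq_fsum => g.
by rewrite mulVKg mulrC.
Qed.

Definition energy phi : R :=
  fsum (fun g => phi g ^+ 2) - fsum (fun g => P phi g * phi g).

(** Expanding the square, with translation invariance of the norm, treats both signs at once: e = -1
    writes the energy as an average of translation defects, and e = 1 gives the positivity of 1 +
    P. *)
Lemma sum_nu_square phi e : has_finsupp phi -> e ^+ 2 = 1 ->
  \sum_(h <- us) nu h * fsum (fun g => (phi (h^-1 * g)%g + e * phi g) ^+ 2) =
  2 * (fsum (fun g => phi g ^+ 2) + e * fsum (fun g => P phi g * phi g)).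
Proof.
move=> fphi e2; rewrite fsum_convolutionM //.
have -> : fsum (fun g => phi g ^+ 2) =
    \sum_(h <- us) nu h * fsum (fun g => phi g ^+ 2).
  by rewrite -mulr_suml sum_nu1 mul1r.
rewrite mulr_sumr -big_split mulr_sumr /=; apply: eq_bigr => h _.
have fs := finsupp_shift h^-1%g fphi.
transitivity (nu h * (fsum (fun g => phi (h^-1 * g)%g ^+ 2)
    + (2 * e) * fsum (fun g => phi (h^-1 * g)%g * phi g)
    + fsum (fun g => phi g ^+ 2))).
  have fs2 := finsuppX2 fs.
  have fm := finsuppZ (2 * e) (finsuppMr phi fs).
  congr (_ * _); rewrite -fsumZ -(fsumD fs2 fm).
  rewrite -(fsumD (finsuppD fs2 fm) (finsuppX2 fphi)).
  by apply: eq_fsum => g; rewrite sqrrD exprMn e2 mul1r; ring.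
rewrite (fsum_shift h^-1%g (fun g => phi g ^+ 2)); ring.
Qed.

Lemma sum_translation_defect phi : has_finsupp phi ->
  \sum_(h <- us) nu h * translation_defect phi h^-1%g = 2 * energy phi.
Proof.
move=> fphi; have N1 : (-1 : R) ^+ 2 = 1 by rewrite sqrrN expr1n.
rewrite /energy -mulN1r -(sum_nu_square fphi N1); apply: eq_bigr => h _; congr (_ * _).
by apply: eq_fsum => g; rewrite mulN1r.
Qed.

Lemma energy_ge0 phi : has_finsupp phi -> 0 <= energy phi.
Proof.
move=> fphi; rewrite -(pmulr_rge0 _ (ltr0Sn R 1)) -sum_translation_defect //.
by apply: sumr_ge0 => h _; rewrite mulr_ge0 // translation_defect_ge0.
Qed.

Lemma fsum_sqrD_convolution_ge0 phi : has_finsupp phi ->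
  0 <= fsum (fun g => phi g ^+ 2) + fsum (fun g => P phi g * phi g).
Proof.
move=> fphi; rewrite -[X in _ + X]mul1r -(pmulr_rge0 _ (ltr0Sn R 1)).
rewrite -(sum_nu_square fphi (expr1n _ 2)).
by apply: sumr_ge0 => h _; rewrite mulr_ge0 // fsum_ge0 // => g; apply: sqr_ge0.
Qed.

(** The elements [x] admitting such a constant form a subgroup, because the defect vanishes at 1, is
    invariant under inversion and is subadditive up to a factor 2. This subgroup contains the
    support of [nu], hence is all of [G]. *)
Lemma translation_defect_le_energy : generates (nu @^-1` [set~ 0]) ->
  forall x, exists2 K, 0 <= K &
    forall phi, has_finsupp phi -> translation_defect phi x <= K * energy phi.
Proof.
move=> nu_gen x.
pose H := [set x | exists2 K, 0 <= K &
    forall phi, has_finsupp phi -> translation_defect phi x <= K * energy phi].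
have : smallest (@is_subgroup G) (nu @^-1` [set~ 0]) x by rewrite nu_gen.
apply: (_ : smallest _ _ `<=` H); apply: smallest_sub => [|y /= /eqP nuy].
  split=> [|y z [K K0 HK] [L L0 HL]|y [K K0 HK]].
  - by exists 0 => // phi fphi; rewrite translation_defect1 mul0r.
  - exists (2 * K + 2 * L) => [|phi fphi]; first by rewrite addr_ge0 ?mulr_ge0.
    apply: le_trans (translation_defectM _ _ fphi) _.
    have := HK _ fphi; have := HL _ fphi; rewrite mulrDl; lra.
  - by exists K => // phi fphi; rewrite translation_defectV HK.
(* The average of the defects is twice the energy; keeping only its term h = y gives this
   constant. *)
exists (2 / nu y) => [|phi fphi]; first by rewrite divr_ge0.
rewrite mulrAC ler_pdivlMr ?lt0r ?nuy ?nu_ge0 // -sum_translation_defect //.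
rewrite (big_rem y) /=; last first.
  by rewrite in_fset_set //; apply: mem_set; apply/eqP.
rewrite translation_defectV mulrC lerDl.
by apply: sumr_ge0 => h _; rewrite mulr_ge0 // translation_defect_ge0.
Qed.

End Convolution.

(** * Convolution powers, return probabilities and the test functions *)

Section ConvolutionPower.
Variables (R : realType) (G : groupType) (nu : G -> R).
Hypothesis nu_prob : finitely_supported_probability nu.
Hypothesis nu_sym : symmetric_measure nu.
Implicit Types (i j k n : nat) (g x : G).

Local Notation pow n := (convolution_power nu n).

Let nu_fin : has_finsupp nu. Proof. by case: nu_prob. Qed.
Let nu_ge0 g : 0 <= nu g. Proof. by case: nu_prob. Qed.

Lemma convolution_powerS n : pow n.+1 = convolution nu (pow n).
Proof. by []. Qed.

Lemma has_finsupp_power n : has_finsupp (pow n).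
Proof.
elim: n => [|n IH]; last by rewrite convolution_powerS; apply: finsupp_convolution.
apply: (@sub_finite_set _ _ [set 1%g]); last exact: finite_set1.
by move=> x /= x1; apply: contrapT => xN; apply: x1; rewrite indicE memNset.
Qed.

Lemma convolution_power_ge0 n g : 0 <= pow n g.
Proof.
elim: n g => [|n IH] g; first by rewrite /convolution_power /= indicE.
by apply: fsum_ge0 => h; rewrite mulr_ge0.
Qed.

Lemma fsum_convolution_power n : fsum (pow n) = 1.
Proof.
elim: n => [|n IH]; last first.
  by rewrite convolution_powerS fsum_convolution //; exact: has_finsupp_power.
rewrite -[RHS](fsum_indic1 (fun=> 1) (1%g : G)).
by apply: eq_fsum => g; rewrite mulr1.
Qed.

Lemma convolution_power_le1 n g : pow n g <= 1.
Proof.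
rewrite -(fsum_convolution_power n) -(big_seq1 +%R g (pow n)).
apply: ler_sum_fsum => //; first exact: has_finsupp_power.
exact: convolution_power_ge0.
Qed.

(** Self-adjointness moves the convolutions one at a time from the left factor to the right one,
    until only the indicator of 1 remains on the left. *)
Lemma fsum_powerM i j : fsum (fun g => pow i g * pow j g) = pow (i + j) 1%g.
Proof.
elim: i j => [|i IH] j; first exact: fsum_indic1.
rewrite addSnnS -IH !convolution_powerS.
by apply: convolution_selfadjoint => //; exact: has_finsupp_power.
Qed.

Lemma fsum_powerX2 i : fsum (fun g => pow i g ^+ 2) = pow (i + i) 1%g.
Proof. by rewrite -fsum_powerM; apply: eq_fsum => g; rewrite expr2. Qed.

(* If nu is supported off an index-2 subgroup, then pow k is supported on a
   single coset of it and varies a lot along nu; adding the next power removes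
   this parity obstruction. *)
Definition power_pair k : G -> R := fun g => pow k g + pow k.+1 g.

Lemma has_finsupp_pair k : has_finsupp (power_pair k).
Proof. by apply: finsuppD; exact: has_finsupp_power. Qed.

Lemma power_pair_ge0 k g : 0 <= power_pair k g.
Proof. by rewrite addr_ge0 // convolution_power_ge0. Qed.

Lemma fsum_power_pair k : fsum (power_pair k) = 2.
Proof.
rewrite fsumD; try exact: has_finsupp_power.
by rewrite !fsum_convolution_power.
Qed.

Lemma power_pair_norm_ge k :
  pow k.*2 1%g <= fsum (fun g => power_pair k g ^+ 2).
Proof.
rewrite -addnn -fsum_powerX2; apply: ler_fsum => [||g].
- exact/finsuppX2/has_finsupp_power.
- exact/finsuppX2/has_finsupp_pair.
- rewrite ler_sqr ?nnegrE ?power_pair_ge0 ?convolution_power_ge0 //.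
  by rewrite lerDl convolution_power_ge0.
Qed.

(** Stated for general [e] because [energy_power_pair] uses both the sum (e = 1) and the difference
    (e = -1) of consecutive powers; likewise for [fsum_conv_lincomb]. *)
Lemma fsum_sqr_lincomb (e : R) k :
  fsum (fun g => (pow k g + e * pow k.+1 g) ^+ 2) =
  pow k.*2 1%g + 2 * e * pow k.*2.+1 1%g + e ^+ 2 * pow k.*2.+2 1%g.
Proof.
have f0 := has_finsupp_power k; have f1 := has_finsupp_power k.+1.
have F1 := finsuppX2 f0.
have F2 := finsuppZ (2 * e) (finsuppMr (pow k.+1) f0).
have F3 := finsuppZ (e ^+ 2) (finsuppX2 f1).
transitivity (fsum (fun g => pow k g ^+ 2 + 2 * e * (pow k g * pow k.+1 g)
   + e ^+ 2 * pow k.+1 g ^+ 2)).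
  by apply: eq_fsum => g; ring.
rewrite (fsumD (finsuppD F1 F2) F3) (fsumD F1 F2) !fsumZ.
by rewrite !fsum_powerX2 fsum_powerM !addnS addSn !addnn.
Qed.

Lemma fsum_conv_lincomb (e : R) k :
  fsum (fun g => convolution nu (fun x => pow k x + e * pow k.+1 x) g *
                 (pow k g + e * pow k.+1 g)) =
  pow k.*2.+1 1%g + 2 * e * pow k.*2.+2 1%g + e ^+ 2 * pow k.*2.+3 1%g.
Proof.
have f0 := has_finsupp_power k; have f1 := has_finsupp_power k.+1.
have f2 := has_finsupp_power k.+2.
have F1 := finsuppMr (pow k) f1.
have F2 := finsuppZ e (finsuppMr (pow k.+1) f1).
have F3 := finsuppZ e (finsuppMr (pow k) f2).
have F4 := finsuppZ (e ^+ 2) (finsuppMr (pow k.+1) f2).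
transitivity (fsum (fun g => pow k.+1 g * pow k g + e * (pow k.+1 g * pow k.+1 g)
   + e * (pow k.+2 g * pow k g) + e ^+ 2 * (pow k.+2 g * pow k.+1 g))).
  apply: eq_fsum => g.
  rewrite (convolutionD nu_prob (pow k) (fun x => e * pow k.+1 x)).
  rewrite (convolutionZ nu_prob) -!convolution_powerS; ring.
rewrite (fsumD (finsuppD (finsuppD F1 F2) F3) F4) (fsumD (finsuppD F1 F2) F3).
rewrite (fsumD F1 F2) !fsumZ !fsum_powerM !addnS !addSn !addnn; ring.
Qed.

(** With p_n the return probability at time n, the energy equals (p_(2k) - p_(2k+2)) + (p_(2k+1) -
    p_(2k+3)). Positivity of 1 + P, tested on the difference of the powers k and k+1, bounds the odd
    decrement by the even one. *)
Lemma energy_power_pair k :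
  energy nu (power_pair k) <= 2 * (pow k.*2 1%g - pow k.*2.+2 1%g).
Proof.
have fN : has_finsupp (fun g => pow k g + (-1) * pow k.+1 g).
  by apply: finsuppD; [|apply: finsuppZ]; exact: has_finsupp_power.
have := fsum_sqrD_convolution_ge0 nu_prob fN.
rewrite fsum_sqr_lincomb fsum_conv_lincomb.
have -> : energy nu (power_pair k) =
    energy nu (fun g => pow k g + 1 * pow k.+1 g).
  by congr (energy nu _); apply/funext => g; rewrite mul1r.
rewrite /energy fsum_sqr_lincomb fsum_conv_lincomb; lra.
Qed.

End ConvolutionPower.

(** * Word length and the supports of convolution powers *)

Section WordMetric.
Variables (R : realType) (G : groupType) (S : set G).
Hypothesis S_sym : symmetric_set S.
Implicit Types (m n : nat) (x y : G).

Lemma set_powD m n x y :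
  set_pow S m x -> set_pow S n y -> set_pow S (m + n) (x * y)%g.
Proof.
elim: m x => [|m IH] x /=; first by move=> ->; rewrite mul1g.
move=> [s Ss [g Sg <-]] Sy; exists s => //.
by exists (g * y)%g; [exact: IH|rewrite mulgA].
Qed.

Lemma set_powV m x : set_pow S m x -> set_pow S m x^-1%g.
Proof.
elim: m x => [|m IH] x /=; first by move=> ->; rewrite invg1.
move=> [s Ss [g Sg <-]]; rewrite invgM.
have S1 : set_pow S 1 s^-1%g.
  by exists s^-1%g; [exact: S_sym|exists 1%g; rewrite ?mulg1].
by have := set_powD (IH _ Sg) S1; rewrite addn1.
Qed.

Lemma set_pow_generates : generates S -> forall x, exists m, set_pow S m x.
Proof.
move=> S_gen x.
have : smallest (@is_subgroup G) S x by rewrite S_gen.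
apply: (_ : smallest _ _ `<=` [set x | exists m, set_pow S m x]).
apply: smallest_sub => [|s Ss /=].
  split=> [|y z [m Sy] [n Sz]|y [m Sy]]; first by exists 0%N.
  - by exists (m + n)%N; exact: set_powD.
  - by exists m; exact: set_powV.
by exists 1%N, s => //; exists 1%g; rewrite ?mulg1.
Qed.

Lemma set_pow_ball m x (t : R) : set_pow S m x -> m%:R <= t -> word_ball S t x.
Proof.
move=> Sx mt; apply: (@le_trans _ _ m%:R%:E); last by rewrite lee_fin.
by apply: ereal_inf_lbound; exists m.
Qed.

Lemma set_pow_bounded (s : seq G) : generates S ->
  exists M, forall x, x \in s -> exists2 m, (m <= M)%N & set_pow S m x.
Proof.
move=> S_gen; elim: s => [|x s [M HM]]; first by exists 0%N.
have [m Sm] := set_pow_generates S_gen x.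
exists (maxn m M) => y; rewrite in_cons => /orP[/eqP ->|/HM [n nM Sn]].
  by exists m => //; rewrite leq_maxl.
by exists n => //; rewrite leq_max nM orbT.
Qed.

Lemma convolution_power_supp (nu : G -> R) : generates S ->
  finitely_supported_probability nu ->
  exists2 M, (0 < M)%N & forall n x, convolution_power nu n x != 0 ->
    exists2 m, (m <= M * n)%N & set_pow S m x.
Proof.
move=> S_gen nu_prob; have [nu_fin _ _] := nu_prob.
have [M HM] := set_pow_bounded (fset_set (nu @^-1` [set~ 0])) S_gen.
(* The successor keeps the constant positive even if [nu] is supported at 1; the radius is later
   divided by it. *)
exists M.+1 => // n; elim: n => [|n IH] x.
  have [->|x1] := eqVneq x 1%g; first by exists 0%N.
  by rewrite /convolution_power /= indicE memNset ?eqxx //; apply/eqP.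
rewrite convolution_powerS convolutionE // => /eqP nz.
have [h hs [nuh Ph]] : exists2 h, h \in fset_set (nu @^-1` [set~ 0]) &
    nu h != 0 /\ convolution_power nu n (h^-1 * x)%g != 0.
  apply: contrapT => H; apply: nz; apply: big1_seq => h /= hs.
  apply: contrapT => /eqP; rewrite mulf_eq0 negb_or => /andP[h1 h2].
  by apply: H; exists h.
have [i iM Si] := HM h hs; have [j jM Sj] := IH _ Ph.
exists (i + j)%N; first by rewrite mulnS leq_add // (leq_trans iM).
by rewrite -[x](mulVKg h); exact: set_powD.
Qed.

End WordMetric.

(** * From a small Rayleigh quotient to a lower bound on J *)

Section Profile.
Variables (R : realType) (G : groupType) (nu : G -> R) (S : set G).
Hypothesis nu_prob : finitely_supported_probability nu.
Hypothesis nu_gen : generates (nu @^-1` [set~ 0]).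
Hypothesis S_fin : finite_set S.
Implicit Types (phi : G -> R).

Lemma sum_translation_le_energy (s : seq G) : exists2 K : R, 0 < K &
  forall phi, has_finsupp phi ->
    \sum_(x <- s) translation_defect phi x <= K * energy nu phi.
Proof.
elim: s => [|x s [K K0 HK]].
  by exists 1 => // phi fphi; rewrite big_nil mul1r energy_ge0.
have [L L0 HL] := translation_defect_le_energy nu_prob nu_gen x.
exists (L + K) => [|phi fphi]; first by rewrite ltr_wpDl.
by rewrite big_cons mulrDl lerD ?HL ?HK.
Qed.

(** Besides bounding the supremum, this shows that the set is bounded above, without which [sup]
    would be a default value. *)
Lemma gradient_ubound phi g :
  ubound [set `|phi (s * g)%g - phi g| | s in S]
    (Num.sqrt (\sum_(s <- fset_set S) (phi (s * g)%g - phi g) ^+ 2)).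
Proof.
move=> _ [s Ss <-]; rewrite -sqrtr_sqr ler_wsqrtr //.
rewrite (big_rem s) /=; last by rewrite in_fset_set //; exact: mem_set.
by rewrite lerDl sumr_ge0 // => x _; apply: sqr_ge0.
Qed.

Lemma gradient_sqr_le phi g :
  gradient S phi g ^+ 2 <=
  \sum_(s <- fset_set S) (phi (s * g)%g - phi g) ^+ 2.
Proof.
have [[s Ss]|/nonemptyPn S0] := pselect (S !=set0); last first.
  rewrite /gradient S0 image_set0 sup0 expr0n.
  by apply: sumr_ge0 => s _; apply: sqr_ge0.
have := @gradient_ubound phi g.
set r := \sum_(s <- _) _ => ub.
have r0 : 0 <= r by apply: sumr_ge0 => x _; apply: sqr_ge0.
have grad0 : 0 <= gradient S phi g.
  apply: (@le_trans _ _ `|phi (s * g)%g - phi g|); first exact: normr_ge0.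
  by apply: ub_le_sup; [exists (Num.sqrt r)|exists s].
rewrite -(sqr_sqrtr r0) ler_sqr ?nnegrE ?sqrtr_ge0 //.
by apply: ge_sup => //; exists `|phi (s * g)%g - phi g|; exists s.
Qed.

Lemma l2norm_fsum phi : has_finsupp phi ->
  l2norm phi = (Num.sqrt (fsum (fun g => phi g ^+ 2)))%:E.
Proof.
move=> fphi; rewrite /l2norm esum_fsum //; first exact: finsuppX2.
by move=> g; apply: sqr_ge0.
Qed.

(** The squared supremum over [S] is at most the sum over [S]; exchanging sums leaves the
    translation defects of the elements of [S], each controlled by the energy. *)
Lemma l2norm_gradient : exists2 K : R, 0 < K &
  forall phi, has_finsupp phi ->
    (l2norm (gradient S phi) <= (Num.sqrt (K * energy nu phi))%:E)%E.
Proof.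
have [K K0 HK] := sum_translation_le_energy (fset_set S).
exists K => // phi fphi.
have e0 : 0 <= K * energy nu phi.
  by apply: mulr_ge0; [exact: ltW|exact: energy_ge0].
rewrite -[X in (_ <= X)%E]/(sqrte (K * energy nu phi)%:E) lee_sqrt ?lee_fin //.
have fD s : has_finsupp (fun g => (phi (s * g)%g - phi g) ^+ 2).
  exact: finsupp_translation.
apply: (@le_trans _ _ (\esum_(g in [set: G])
    (\sum_(s <- fset_set S) (phi (s * g)%g - phi g) ^+ 2)%:E)%E).
  by apply: le_esum => g _; rewrite lee_fin gradient_sqr_le.
rewrite esum_fsum; last 2 first.
- exact: finsupp_sum.
- by move=> g; apply: sumr_ge0 => s _; apply: sqr_ge0.
by rewrite lee_fin fsum_sum //; exact: HK.
Qed.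

(** A separate positive [d] bounds the Rayleigh quotient, so that functions of zero energy are
    covered as well. *)
Lemma isoperimetric_J_ge : exists2 K : R, 0 < K &
  forall phi (t d : R), has_finsupp phi ->
    phi @^-1` [set~ 0] `<=` word_ball S t ->
    0 < fsum (fun g => phi g ^+ 2) -> 0 < d ->
    energy nu phi <= d * fsum (fun g => phi g ^+ 2) ->
    ((Num.sqrt (K * d)^-1)%:E <= isoperimetric_J S t)%E.
Proof.
have [K K0 HK] := l2norm_gradient.
exists K => // phi t d fphi phiS; set N := fsum _ => N0 d0 ed.
apply: (@le_trans _ _ (l2norm phi / l2norm (gradient S phi))%E); last first.
  apply: ereal_sup_ubound; exists phi => //; split => //.
    move=> phi0; move: N0; rewrite /N phi0 (_ : fsum _ = 0) ?ltxx //.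
    by apply: fsbig1 => g _; rewrite expr0n.
  by rewrite l2norm_fsum // ltry.
have N0' : 0 < Num.sqrt N by rewrite sqrtr_gt0.
have := HK phi fphi; rewrite (l2norm_fsum fphi) -/N.
have : (0 <= l2norm (gradient S phi))%E by exact: sqrte_ge0.
case: (l2norm _) => [r| |] //; rewrite !lee_fin => r0 rK.
(* When the gradient vanishes, the quotient is +oo and the bound is immediate. *)
rewrite inver; case: ifPn => [_|rN0]; first by rewrite gt0_muley ?leey ?lte_fin.
have {}r0 : 0 < r by rewrite lt_def rN0.
have Kd0 : 0 < K * d by rewrite mulr_gt0.
rewrite -EFinM lee_fin ler_pdivlMr // sqrtrV ?(ltW Kd0) //.
rewrite ler_pdivrMl ?sqrtr_gt0 // -sqrtrM ?(ltW Kd0) //; apply: (le_trans rK).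
by apply: ler_wsqrtr; rewrite -mulrA ler_pM2l.
Qed.

End Profile.

(** * Slowly decaying sequences and growth exponents *)

Section Decay.
Variable R : realType.

(** Otherwise each step before [m] multiplies [u] by less than 1 - d <= exp(-d), and [u m] falls
    strictly below exp(-dm). *)
Lemma exists_slow_decay (u : nat -> R) (d : R) m :
  (forall k, 0 < u k) -> u 0%N <= 1 -> (0 < m)%N -> expR (- (d * m%:R)) <= u m ->
  exists2 k, (k < m)%N & u k - u k.+1 <= d * u k.
Proof.
move=> u0 u01 m0 um; apply: contrapT => H.
have step k : (k < m)%N -> u k.+1 < expR (- d) * u k.
  move=> km; have uk : d * u k < u k - u k.+1.
    by rewrite ltNge; apply/negP => le; apply: H; exists k.
  apply: (@lt_le_trans _ _ ((1 - d) * u k)); first by rewrite mulrBl mul1r; lra.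
  by rewrite ler_pM2r // expR_ge1Dx.
have le_exp k : (k <= m)%N -> u k <= expR (- (d * k%:R)).
  elim: k => [|k IH] km; first by rewrite mulr0 oppr0 expR0.
  apply: (le_trans (ltW (step _ km))).
  rewrite -natr1 mulrDr mulr1 opprD addrC expRD ler_pM2l ?expR_gt0 //.
  exact/IH/ltnW.
(* The iterated bound is only a weak inequality; peeling off the last step recovers a strict one. *)
case: m m0 um H step le_exp => // m _ um _ step le_exp.
suff: u m.+1 < u m.+1 by rewrite ltxx.
apply: lt_le_trans (step m (ltnSn m)) _; apply: le_trans um.
rewrite -natr1 mulrDr mulr1 opprD addrC expRD.
by rewrite ler_pM2l ?expR_gt0 // le_exp.
Qed.

Lemma limf_einf_ge (f : R -> \bar R) (a : R) :
  (forall e, 0 < e -> \forall t \near +oo, ((a - e)%:E <= f t)%E) ->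
  (a%:E <= limf_einf f (pinfty_nbhs R))%E.
Proof.
move=> H; apply/lee_addgt0Pr => e e0.
rewrite -leeBlDr // -EFinB limf_einfE.
apply: (@le_trans _ _ (ereal_inf (f @` [set t | ((a - e)%:E <= f t)%E]))).
  by apply: le_ereal_inf_tmp => _ [t /= ft <-].
by apply: ereal_sup_ubound; exists [set t | ((a - e)%:E <= f t)%E] => //; exact: H.
Qed.

(** ln (B t^a) / ln t = a + ln B / ln t, and the last term tends to 0. *)
Lemma power_growth_exponent (J : R -> \bar R) (a B : R) : 0 < B ->
  (\forall t \near +oo, ((B * t `^ a)%:E <= J t)%E) ->
  (a%:E <= limf_einf (fun t => lne (J t) / (ln t)%:E)%E (pinfty_nbhs R))%E.
Proof.
move=> B0 HJ; apply: limf_einf_ge => e e0.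
near=> t.
(* This threshold makes |ln B| at most e ln t; the extra 1 makes ln t positive. *)
have t1 : expR (`|ln B| / e + 1) <= t.
  by near: t; apply: nbhs_pinfty_ge; exact: num_real.
have t0 : 0 < t by apply: lt_le_trans t1; exact: expR_gt0.
have lnt : `|ln B| / e + 1 <= ln t by rewrite -ler_expR lnK.
have Be : 0 <= `|ln B| / e by rewrite divr_ge0 // ltW.
have lnt0 : 0 < ln t by apply: lt_le_trans lnt; rewrite ltr_wpDl.
have Bt : 0 < B * t `^ a by rewrite mulr_gt0 // powR_gt0.
have Jt : ((B * t `^ a)%:E <= J t)%E by near: t.
rewrite inver gt_eqF // lee_pdivlMr //.
apply: (@le_trans _ _ (lne (B * t `^ a)%:E)); last first.
  have B0t : (0 <= (B * t `^ a)%:E)%E by rewrite lee_fin ltW.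
  by rewrite lee_lne // in_itv /= leey andbT // (le_trans B0t Jt).
rewrite lne_EFin // -EFinM lee_fin lnM ?posrE ?powR_gt0 // ln_powR.
have : `|ln B| <= e * ln t.
  by rewrite mulrC -ler_pdivrMr //; lra.
by rewrite ler_norml mulrBl => /andP[]; lra.
Unshelve. all: by end_near. Qed.

End Decay.

(** * Consequences of the lower bound on return probabilities *)

Section ReturnProbability.
Variables (R : realType) (G : groupType) (nu : G -> R) (gamma : R).
Hypothesis nu_prob : finitely_supported_probability nu.
Hypothesis nu_sym : symmetric_measure nu.
Hypothesis nu_return : exists c C : R, [/\ 0 < c, 0 < C &
  forall n : nat, (0 < n)%N -> ~~ odd n ->
    c * expR (- C * n%:R `^ gamma) <= convolution_power nu n 1%g].
Implicit Types (k m n : nat).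

Local Notation pow n := (convolution_power nu n).

Lemma convolution_power0 : pow 0 1%g = 1.
Proof. by rewrite /convolution_power /= indicE mem_set. Qed.

Lemma return_gt0 k : 0 < pow k.*2 1%g.
Proof.
case: k => [|k]; first by rewrite double0 convolution_power0.
have [c [C [c0 C0 H]]] := nu_return.
apply: lt_le_trans (H _ _ _); rewrite ?odd_double //.
by rewrite mulr_gt0 // expR_gt0.
Qed.

(** The exponent [g] is [gamma] itself when [gamma] is positive and 0 otherwise; being nonnegative,
    it lets all constants go into [A]. *)
Lemma return_lower_bound g : 0 <= g < 1 -> gamma <= g ->
  exists2 A : R, 0 < A & forall m, (0 < m)%N ->
    expR (- (A * m%:R `^ g)) <= pow m.*2 1%g.
Proof.
move=> /andP[g0 g1] gg; have [c [C [c0 C0 H]]] := nu_return.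
(* The factor 2 comes from (2m)^g <= 2 m^g, and |ln c| absorbs [c] because m^g >= 1. *)
exists (C * 2 + `|ln c|) => [|m m0].
  by rewrite ltr_wpDr // mulr_gt0.
have m1 : (1 : R) <= m%:R by rewrite ler1n.
have mg1 : 1 <= (m%:R : R) `^ g by have := ler_powR m1 g0; rewrite powRr0.
have le2 : m.*2%:R `^ gamma <= 2 * (m%:R : R) `^ g.
  apply: (@le_trans _ _ (m.*2%:R `^ g)).
    by apply: ler_powR; rewrite // ler1n double_gt0.
  rewrite -muln2 natrM mulrC powRM // ler_pM2r ?powR_gt0 ?ltr0n //.
  by apply: ler1_powR; [rewrite ler1n|exact: ltW].
apply: le_trans (H _ _ _); rewrite ?double_gt0 ?odd_double //.
rewrite -[c in leRHS]lnK ?posrE // -expRD ler_expR.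
have h1 : `|ln c| <= `|ln c| * (m%:R : R) `^ g by rewrite ler_peMr.
have h2 : - `|ln c| <= ln c by rewrite lerNl -normrN ler_norm.
have h3 : C * m.*2%:R `^ gamma <= C * (2 * (m%:R : R) `^ g) by rewrite ler_pM2l.
by rewrite mulNr; lra.
Qed.

Lemma exists_low_energy_pair g : 0 <= g < 1 -> gamma <= g ->
  exists2 A : R, 0 < A & forall m, (0 < m)%N -> exists2 k, (k < m)%N &
    energy nu (power_pair nu k) <= A * m%:R `^ (g - 1) * pow k.*2 1%g.
Proof.
move=> g01 gg; have [A A0 HA] := return_lower_bound g01 gg.
exists (2 * A) => [|m m0]; first by rewrite mulr_gt0.
(* The rate A m^(g-1) is chosen so that m steps of it add up to A m^g. *)
have [||k km Hk] := @exists_slow_decay R (fun k => pow k.*2 1%g)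
    (A * m%:R `^ (g - 1)) m return_gt0 _ m0 _.
- by rewrite double0 convolution_power0.
- apply: le_trans (HA _ m0); rewrite ler_expR lerN2 -mulrA ler_pM2l //.
  have m0' : (0 : R) < m%:R by rewrite ltr0n.
  by rewrite -[in leLHS](subrK 1 g) powRD ?powRr1 ?(ltW m0') // (lt0r_neq0 m0') implybT.
- exists k => //; apply: (le_trans (energy_power_pair nu_prob nu_sym k)).
  by rewrite -!mulrA ler_pM2l // mulrA -doubleS.
Qed.

(** With exponent 0, even return probabilities stay above a constant c while some pair has energy
    O(1/m). For large m that pair is at least c/2 on a given finite set, which its total mass 2
    limits to 4/c elements. *)
Lemma return_bounded_finite : generates (nu @^-1` [set~ 0]) ->
  gamma <= 0 -> finite_set [set: G].
Proof.
move=> nu_gen gamma0.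
have g01 : 0 <= (0 : R) < 1 by rewrite lexx ltr01.
have [A A0 HA] := return_lower_bound g01 gamma0.
have [L L0 HL] := exists_low_energy_pair g01 gamma0.
pose c := expR (- A); have c0 : 0 < c by exact: expR_gt0.
have even_ge m : c <= pow m.*2 1%g.
  case: m => [|m].
    by rewrite double0 convolution_power0 -expR0 ler_expR oppr_le0 ltW.
  by apply: le_trans (HA _ (ltn0Sn m)); rewrite powRr0 mulr1.
(* One of k and k+1 is even. *)
have pair_ge k : c <= power_pair nu k 1%g.
  have := convolution_power_ge0 nu_prob k 1%g.
  have := convolution_power_ge0 nu_prob k.+1 1%g.
  rewrite /power_pair; have := odd_double_half k; case: (odd k) => <-.
    by rewrite add1n -doubleS => h1 h2; have := even_ge (k./2.+1); lra.
  by rewrite add0n => h1 h2; have := even_ge (k./2); lra.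
apply: contrapT => /(infinite_set_fset (Num.truncn (4 / c)).+1) [B _ Bn].
have [K K0 HK] := sum_translation_le_energy nu_prob nu_gen B.
(* This makes K L / m smaller than (c/2)^2. *)
pose m := (Num.truncn (K * L * 4 / c ^+ 2)).+1.
have [k _ Hk] := HL m (ltn0Sn _).
set phi := power_pair nu k in Hk.
have fphi : has_finsupp phi by exact: has_finsupp_pair.
have m0 : (0 : R) < m%:R by rewrite ltr0n.
have KE : K * energy nu phi < (c / 2) ^+ 2.
  apply: (@le_lt_trans _ _ (K * (L / m%:R))).
    rewrite ler_pM2l //; apply: (le_trans Hk).
    rewrite sub0r powR_inv1 ?(ltW m0) // -[leRHS]mulr1 ler_pM2l ?divr_gt0 //.
    exact: convolution_power_le1.
  rewrite mulrA ltr_pdivrMr //.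
  have := truncnS_gt (K * L * 4 / c ^+ 2); rewrite -/m.
  rewrite ltr_pdivrMr ?exprn_gt0 //; rewrite expr_div_n; lra.
have phi_ge x : x \in B -> c / 2 <= phi x.
  (* The square is the term g = 1 of the defect at [x]. *)
  move=> xB; have lt_sq : (phi x - phi 1%g) ^+ 2 < (c / 2) ^+ 2.
    apply: le_lt_trans KE; apply: le_trans (HK _ fphi).
    rewrite (big_rem x) //= ler_wpDr ?sumr_ge0 // => [y _|].
      exact: translation_defect_ge0.
    have := @ler_sum_fsum R G (fun g => (phi (x * g)%g - phi g) ^+ 2) [:: 1%g].
    rewrite big_seq1 mulg1; apply=> // [|y]; last exact: sqr_ge0.
    exact: finsupp_translation.
  have : `|phi x - phi 1%g| < c / 2.
    by rewrite -ltr_sqr ?nnegrE ?normr_ge0 ?divr_ge0 ?ltW // real_normK ?num_real.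
  by rewrite ltr_norml => /andP[]; have := pair_ge k; rewrite -/phi; lra.
have : (#|` B|)%:R * (c / 2) <= 2.
  rewrite -[leRHS](fsum_power_pair nu_prob k).
  apply: le_trans (ler_sum_fsum (fset_uniq B) fphi (power_pair_ge0 nu_prob k)).
  rewrite card_fset_sum1 natr_sum mulr_suml big_seq [leRHS]big_seq.
  by apply: ler_sum => x xB; rewrite mul1r; exact: phi_ge.
apply/negP; rewrite -ltNge.
have h1 := truncnS_gt (4 / c).
have h2 : (Num.truncn (4 / c)).+1%:R <= #|` B|%:R :> R by rewrite ler_nat.
have : 4 < #|` B|%:R * c by rewrite -ltr_pdivrMr // (lt_le_trans h1).
lra.
Qed.

End ReturnProbability.

(** * Assembling the bound on the exponent *)

Theorem proposition15 (R : realType) (G : groupType)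
    (S : set G) (nu : G -> R) (gamma : R)
    (hG : finitely_generated G)
    (S_fin : finite_set S) (S_sym : symmetric_set S) (S_gen : generates S)
    (nu_prob : finitely_supported_probability nu)
    (nu_sym : symmetric_measure nu)
    (nu_gen : generates (nu @^-1` [set~ 0]))
    (gamma_lt1 : gamma < 1)
    (nu_return : exists c C : R, [/\ 0 < c, 0 < C &
       forall n : nat, (0 < n)%N -> ~~ odd n ->
         c * expR (- C * n%:R `^ gamma) <= convolution_power nu n 1%g]) :
  (((1 - gamma) / 2)%:E <= isoperimetric_exponent R S)%E.
Proof.
have [K K0 HK] := isoperimetric_J_ge nu_prob nu_gen S_fin.
have [gamma0|gamma0] := leP gamma 0.
  have Gfin := return_bounded_finite nu_prob nu_sym nu_return nu_gen gamma0.
  (* A finite group lies in one ball, so the constant function 1 is eventually admissible. *)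
  have [M HM] := set_pow_bounded S_sym (fset_set [set: G]) S_gen.
  have Gfs (f : G -> R) : has_finsupp f by exact: sub_finite_set Gfin.
  apply: (@power_growth_exponent _ _ _ 1) => //.
  near=> t.
  have tM : M%:R <= t by near: t; apply: nbhs_pinfty_ge; exact: num_real.
  have t0 : 0 < t by near: t; apply: nbhs_pinfty_gt; exact: num_real.
  set b := t `^ _; have b0 : 0 < b by exact: powR_gt0.
  (* The constant function has zero energy, so any positive rate is allowed; this one turns the
     lower bound on J into exactly [b]. *)
  have d0 : 0 < (K * b ^+ 2)^-1 by rewrite invr_gt0 mulr_gt0 // exprn_gt0.
  have := HK (cst 1) t _ (Gfs _) _ _ d0.
  have -> : K * (K * b ^+ 2)^-1 = (b ^+ 2)^-1.
    by rewrite invfM mulVKf // gt_eqF.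
  rewrite invrK sqrtr_sqr gtr0_norm // mul1r.
  apply=> [x _||].
  - have [|m mM Sm] := HM x; first by rewrite in_fset_set // in_setT.
    by apply: set_pow_ball Sm _; apply: le_trans tM; rewrite ler_nat.
  - apply: lt_le_trans (@ler_sum_fsum R G _ [:: 1%g] _ _ _) => // [|g].
      by rewrite big_seq1 expr1n.
    exact: sqr_ge0.
  - rewrite /energy (_ : fsum (fun g => convolution nu (cst 1) g * cst 1 g) =
        fsum (fun g : G => cst 1 g ^+ 2)).
      rewrite subrr mulr_ge0 ?(ltW d0) // fsum_ge0 // => g; exact: sqr_ge0.
    rewrite (eq_fsum (fun g => mulr1 _)) fsum_convolution //.
    by apply: eq_fsum => g; rewrite expr1n.
have g01 : 0 <= gamma < 1 by rewrite ltW.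
have [A A0 HA] := exists_low_energy_pair nu_prob nu_sym nu_return g01 (lexx _).
have [M M0 HM] := convolution_power_supp S_sym S_gen nu_prob.
have M0' : (0 : R) < M%:R by rewrite ltr0n.
set a := (1 - gamma) / 2.
have a0 : 0 <= a by rewrite divr_ge0 // subr_ge0 ltW.
have M2 : (0 : R) < (2 * M%:R)^-1 by rewrite invr_gt0 mulr_gt0.
(* J is at least (K A m^(gamma-1))^(-1/2) = (K A)^(-1/2) m^a, and m >= t/(2M) is arranged below. *)
apply: (@power_growth_exponent _ _ _
  ((K * A)^-1 `^ 2^-1 * (2 * M%:R)^-1 `^ a)).
  by rewrite mulr_gt0 // powR_gt0 // invr_gt0 mulr_gt0.
near=> t.
have tM : 2 * M%:R <= t by near: t; apply: nbhs_pinfty_ge; exact: num_real.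
have t0 : 0 < t by apply: lt_le_trans tM; rewrite mulr_gt0.
have tM0 : 0 <= t / M%:R by rewrite divr_ge0 ?ltW.
(* The pair of index k < m is supported at word length at most M(k+1) <= M m <= t; the strict
   inequality k < m pays for the power k+1. *)
pose m := Num.truncn (t / M%:R).
have mt : M%:R * m%:R <= t.
  by rewrite mulrC -ler_pdivlMr // truncn_le.
(* Rounding down loses at most a factor 2 because t/M >= 2. *)
have tm : t * (2 * M%:R)^-1 <= m%:R.
  have : t / M%:R < m%:R + 1 by rewrite natr1; exact: truncnS_gt.
  have : 2 <= t / M%:R by rewrite ler_pdivlMr.
  have -> : t * (2 * M%:R)^-1 = 2^-1 * (t / M%:R) by rewrite invfM mulrCA.
  lra.
have m0' : (0 : R) < m%:R.
  by apply: lt_le_trans tm; rewrite mulr_gt0.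
have m0 : (0 < m)%N by rewrite -(ltr0n R).
have [k km Ek] := HA m m0.
have d0 : 0 < A * m%:R `^ (gamma - 1) by rewrite mulr_gt0 // powR_gt0.
have pk := power_pair_norm_ge nu_prob nu_sym k.
have pk0 := return_gt0 nu_return k.
apply: le_trans (HK (power_pair nu k) t _ (has_finsupp_pair nu_prob k) _ _ d0 _).
- have -> : (K * (A * m%:R `^ (gamma - 1)))^-1 =
      (K * A)^-1 * m%:R `^ (1 - gamma).
    by rewrite mulrA invfM -powRN opprB.
  have KA0 : 0 <= (K * A)^-1 by rewrite invr_ge0 mulr_ge0 ?ltW.
  rewrite lee_fin sqrtrM // -!powR12_sqrt ?powR_ge0 // -powRrM -/a -mulrA.
  apply: ler_wpM2l; first exact: powR_ge0.
  rewrite -powRM ?(ltW t0) ?(ltW M2) //; apply: ge0_ler_powR => //.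
  + by rewrite nnegrE mulr_ge0 ?ltW.
  + by rewrite nnegrE.
  + by rewrite mulrC.
- move=> x /= /eqP phix.
  have [j jm Sj] : exists2 j, (j <= M * k.+1)%N & set_pow S j x.
    have [pkx|pkx] := eqVneq (convolution_power nu k x) 0.
      by apply: HM; move: phix; rewrite /power_pair pkx add0r.
    have [j jm Sj] := HM _ _ pkx; exists j => //.
    by rewrite (leq_trans jm) // leq_mul2l leqnSn orbT.
  apply: set_pow_ball Sj _; apply: le_trans mt.
  by rewrite -natrM ler_nat (leq_trans jm) // leq_mul2l km orbT.
- exact: lt_le_trans pk.
- by apply: (le_trans Ek); rewrite ler_pM2l.
Unshelve. all: by end_near. Qed.
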